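(* In the setting of the context (a weighted genus two admissible cover over the standard log point, with real-metrised tropicalisation $\Gamma$ and associated function $\lambda$), let $\Delta_1^\circ$ be a connected component of $\Delta^\circ=\{\lambda>0\}$ of genus one. Then there is at least one vertex of positive weight on the boundary of $\Delta_1^\circ$.
   Context: *Admissible cover.* Over $\mathbb C$, let $\psi\colon(C,D_R)\to(T,D_B)$ be a hyperelliptic admissible cover: a finite degree two morphism of nodal curves, $C$ connected of arithmetic genus $2$, $T$ of genus $0$, étale on $C^{sm}\setminus D_R$, simply ramified along the six smooth points $D_R$ mapping to six distinct smooth points $D_B$, mapping nodes to nodes with the same ramification order $1$ or $2$ on both branches. It carries a weight $w\colon V(\Gamma)\to\mathbb N$ on the dual graph of $C$, not identically zero, such that with $w_T(v)=\sum_{v'\mapsto v}w(v')$ every component of $T$ with $w_T=0$ has at least three nodes or branch points. *Metric.* $\Gamma=\mathrm{trop}(C)$ and the tree $\Gamma_T=\mathrm{trop}(T)$ are the dual graphs with positive real edge lengths, where the length of an edge of $\Gamma_T$ is the ramification order (expansion factor) times the length of any edge of $\Gamma$ above it; $\mathrm{trop}(\psi)\colon\Gamma\to\Gamma_T$ is the induced harmonic map of degree two. For a subcurve, genus means arithmetic genus: first Betti number plus sum of vertex genera. *Functions.* A piecewise linear (PL) function has integral slopes on (a subdivision of) $\Gamma$ (half-integral slopes allowed on $\Gamma_T$); $\mathrm{div}(\lambda)(v)$ is the sum of outgoing slopes at $v$; $K_\Gamma(v)=2g(v)-2+\mathrm{val}(v)$. Pullback along $\mathrm{trop}(\psi)$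 composes functions and multiplies divisors by local degrees. On $\Gamma_T$ let $D'(v)=\mathrm{val}(v)-2+\tfrac12\deg(D_B|_v)$ (valence counts edges only); it has degree $1$ and pulls back to $K_\Gamma$. For each vertex $v_0$ of $\Gamma_T$ there is a PL function $\overline\lambda_T$, unique up to constants, with $D'+\mathrm{div}(\overline\lambda_T)=v_0$; its pullback to $\Gamma$ is an *admissible function*. Let $\overline\lambda_1,\dots,\overline\lambda_s$ be all of them and let $\lambda_i$ be $\overline\lambda_i$ shifted by a constant so that vertices with $\lambda_i>0$ have weight $0$ while those with $\lambda_i\ge0$ have total weight $\ge1$ (i.e. the maximum of $\lambda_i$ on vertices of positive weight is $0$). Define $\lambda=\max\{0,\lambda_1,\dots,\lambda_s\}$, a PL function on a subdivision of $\Gamma$ (new vertices have weight $0$), pulled back from a PL function on $\Gamma_T$, and put $\Delta^\circ=\{\lambda>0\}$. *)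

(* Defs.v *)
From HB Require Import structures.
From mathcomp Require Import all_boot all_order all_algebra.
From mathcomp Require Import reals.

Set Implicit Arguments.
Unset Strict Implicit.
Unset Printing Implicit Defensive.

Import Order.TTheory GRing.Theory Num.Theory.
Local Open Scope ring_scope.

(* The orientation (src, tgt) of the edges is auxiliary: it only serves to
   name the two half-edges of an edge. *)
Record multigraph := Multigraph {
  vert : finType;
  edge : finType;
  src : edge -> vert;
  tgt : edge -> vert }.

Section Multigraph.
Variable G : multigraph.

Definition adj : rel (vert G) := fun x y =>
  [exists e : edge G, ((src e == x) && (tgt e == y)) ||
                      ((src e == y) && (tgt e == x))].

Definition adj_in (A : {set vert G}) : rel (vert G) := fun x y =>
  [&& x \in A, y \in A & adj x y].

(* Number of half-edges at v. *)
Definition valence (v : vert G) : nat :=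
  (#|[set e : edge G | src e == v]| + #|[set e : edge G | tgt e == v]|)%N.

Definition connected_graph : Prop :=
  (0 < #|vert G|)%N /\ forall x y : vert G, connect adj x y.

Definition is_tree : Prop :=
  connected_graph /\ #|vert G| = #|edge G|.+1.

Definition inner_edges (A : {set vert G}) : {set edge G} :=
  [set e | (src e \in A) && (tgt e \in A)].

Definition betti1 (A : {set vert G}) : int :=
  #|inner_edges A|%:Z - #|A|%:Z + (n_comp (adj_in A) A)%:Z.

(* Arithmetic genus of the subcurve whose components are the vertices in A. *)
Definition arith_genus (g : vert G -> nat) (A : {set vert G}) : int :=
  betti1 A + (\sum_(v in A) g v)%N%:Z.

Definition is_component (D A : {set vert G}) : Prop :=
  exists2 x, x \in D & A = [set y | connect (adj_in D) x y].

Definition vertex_boundary (A : {set vert G}) : {set vert G} :=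
  [set v | (v \notin A) && [exists u in A, adj u v]].

End Multigraph.

(* The metrised dual graphs of a weighted hyperelliptic admissible cover
   psi : (C, D_R) -> (T, D_B) with C of arithmetic genus 2.
   - Edges of Gam are oriented by pulling back an orientation of GamT.
   - ldeg v is the degree of psi on the component v; mult e is the common
     ramification order of psi on the two branches of the node e.
   - ram i is the component carrying the i-th point of D_R; the i-th point of
     D_B lies on the component fV (ram i). *)
Record admissible_cover (R : realType) := AdmissibleCover {
  Gam : multigraph;
  GamT : multigraph;
  fV : vert Gam -> vert GamT;
  fE : edge Gam -> edge GamT;
  ldeg : vert Gam -> nat;
  mult : edge Gam -> nat;
  vgen : vert Gam -> nat;
  ram : 'I_6 -> vert Gam;
  wt : vert Gam -> nat;
  len : edge Gam -> R;
  lenT : edge GamT -> R;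

  fE_src : forall e, fV (src e) = src (fE e);
  fE_tgt : forall e, fV (tgt e) = tgt (fE e);

  Gam_connected : connected_graph Gam;
  Gam_genus : arith_genus vgen [set: vert Gam] = 2;
  GamT_tree : is_tree GamT;

  ldeg_gt0 : forall v, (0 < ldeg v)%N;
  mult12 : forall e, mult e = 1%N \/ mult e = 2%N;
  deg_two : forall v : vert GamT, (\sum_(v' | fV v' == v) ldeg v' = 2)%N;
  harmonic_src : forall (v : vert Gam) (e : edge GamT), src e = fV v ->
    (\sum_(e' | (fE e' == e) && (src e' == v)) mult e' = ldeg v)%N;
  harmonic_tgt : forall (v : vert Gam) (e : edge GamT), tgt e = fV v ->
    (\sum_(e' | (fE e' == e) && (tgt e' == v)) mult e' = ldeg v)%N;

  ldeg_ram : forall i, ldeg (ram i) = 2%N;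
  (* Riemann-Hurwitz for the component v over a component isomorphic to P^1,
     i.e. 2 g(v) - 2 = -2 ldeg(v) + (total ramification): the cover is simply
     ramified at the points of D_R, ramified to order mult e at the node e,
     and etale elsewhere. *)
  riemann_hurwitz : forall v,
    (2 * vgen v + 2 * ldeg v =
     2 + (#|[set i | ram i == v]| +
          (\sum_(e | src e == v) (mult e - 1) +
           \sum_(e | tgt e == v) (mult e - 1))))%N;

  wt_neq0 : exists v, wt v <> 0%N;
  stability : forall v : vert GamT,
    (\sum_(v' | fV v' == v) wt v' = 0)%N ->
    (3 <= valence v + #|[set i | fV (ram i) == v]|)%N;

  len_gt0 : forall e, 0 < len e;
  lenT_gt0 : forall e, 0 < lenT e;
  len_dilation : forall e, lenT (fE e) = (mult e)%:R * len e }.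

Section Functions.
Variables (R : realType) (C : admissible_cover R).

(* Functions on GamT that are linear on edges are given by their values at the
   vertices. *)
Definition slopeT (f : vert (GamT C) -> R) (e : edge (GamT C)) : R :=
  (f (tgt e) - f (src e)) / lenT e.

Definition PL_T (f : vert (GamT C) -> R) : Prop :=
  forall e, exists k : int, 2 * slopeT f e = k%:~R.

Definition divT (f : vert (GamT C) -> R) (v : vert (GamT C)) : R :=
  \sum_(e | src e == v) slopeT f e - \sum_(e | tgt e == v) slopeT f e.

Definition Dprime (v : vert (GamT C)) : R :=
  (valence v)%:R - 2 + #|[set i | fV (ram C i) == v]|%:R / 2.

Definition admissible_at (v0 : vert (GamT C)) (f : vert (GamT C) -> R) : Prop :=
  PL_T f /\ forall v, Dprime v + divT f v = (v == v0)%:R.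

Definition pullback (f : vert (GamT C) -> R) : vert (Gam C) -> R :=
  fun v => f (fV v).

Definition normalised (f : vert (Gam C) -> R) : Prop :=
  (forall v, 0 < f v -> wt v = 0%N) /\
  (1 <= \sum_(v | (0 <= f v)%R) wt v)%N.

(* Value at distance t from src e of the function that is linear on the edges
   of Gam, with values f at the vertices. *)
Definition on_edge (f : vert (Gam C) -> R) (e : edge (Gam C)) (t : R) : R :=
  f (src e) + t / len e * (f (tgt e) - f (src e)).

(* lamT v0 is the function on GamT attached to the vertex v0. *)
Variable lamT : vert (GamT C) -> vert (GamT C) -> R.

Definition lam_vert (v : vert (Gam C)) : R :=
  \big[Num.max/0]_(v0 : vert (GamT C)) pullback (lamT v0) v.

Definition lam_edge (e : edge (Gam C)) (t : R) : R :=
  \big[Num.max/0]_(v0 : vert (GamT C)) on_edge (pullback (lamT v0)) e t.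

(* A subdivision of Gam is given by cutting each edge e at the points at
   distance t from src e, for t in cuts e. *)
Record subdivision := Subdivision {
  cuts : edge (Gam C) -> seq R;
  cuts_sorted : forall e, sorted (fun s t : R => s < t) (cuts e);
  cuts_in : forall e t, t \in cuts e -> 0 < t < len e }.

Variable S : subdivision.

(* brk e 0 = 0 < brk e 1 < ... < brk e (size (cuts e)).+1 = len e. *)
Definition brk (e : edge (Gam C)) (i : nat) : R :=
  nth (len e) (0 :: cuts S e) i.

Definition sub_vert : finType :=
  (vert (Gam C) + {e : edge (Gam C) & 'I_(size (cuts S e))})%type.

(* The piece i of e is the segment [brk e i, brk e i.+1]. *)
Definition sub_edge : finType :=
  {e : edge (Gam C) & 'I_(size (cuts S e)).+1}.

(* The vertex of the subdivision located at brk e i. *)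
Definition brk_vert (e : edge (Gam C)) (i : nat) : sub_vert :=
  if i is j.+1 then
    if insub j is Some k
    then inr (existT (fun e' => 'I_(size (cuts S e'))) e k)
    else inl (tgt e)
  else inl (src e).

Definition subdivided : multigraph :=
  @Multigraph sub_vert sub_edge
    (fun p => brk_vert (tag p) (tagged p))
    (fun p => brk_vert (tag p) (tagged p).+1).

Definition sub_vgen (x : vert subdivided) : nat :=
  if x is inl v then vgen v else 0%N.

Definition sub_wt (x : vert subdivided) : nat :=
  if x is inl v then wt v else 0%N.

Definition sub_lam (x : vert subdivided) : R :=
  match x with
  | inl v => lam_vert v
  | inr p => lam_edge (tag p) (brk (tag p) (tagged p).+1)
  end.

(* lambda is linear on every edge of the subdivision. *)
Definition lam_linear : Prop :=
  forall (e : edge (Gam C)) (i : nat) (t : R), (i <= size (cuts S e))%N ->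
    let a := brk e i in let b := brk e i.+1 in
    a <= t <= b ->
    (b - a) * lam_edge e t = (b - t) * lam_edge e a + (t - a) * lam_edge e b.

Definition Delta_open : {set vert subdivided} := [set x | 0 < sub_lam x].

End Functions.

(* Main.v *)
Require Import Defs.
From mathcomp Require Import all_boot all_order all_algebra.
From mathcomp Require Import boolp reals.
From mathcomp Require Import zify lra.

(* Let [U] be the component of {lambda_T > 0} in the tree [GamT] below [Delta1].
   Riemann-Hurwitz shows that [Delta1] has degree two over [U] (in degree one
   its genus would be 0), and that its genus is 2 minus the sum of floor(b/2)
   over the edges leaving [U], [b] being the number of branch points beyond the
   edge.  So for genus one, at most one edge leaving [U] has b >= 2, and b <= 3
   there.  The slope of [lamT v0] along an edge, directed away from [U], is
   b/2 - 1 if [v0] is not beyond the edge and b/2 - 2 otherwise.  Taking for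
   [v0] the vertex outside [U] furthest from [U] having two branch points at or
   beyond it, [lamT v0] is strictly decreasing away from [U].  It is <= 0 on
   the boundary of [U], hence negative beyond it; but by normalisation it
   vanishes at a vertex of positive weight, which must lie on the boundary. *)

Set Implicit Arguments.
Unset Strict Implicit.
Unset Printing Implicit Defensive.

Import Order.TTheory GRing.Theory Num.Theory.
Local Open Scope ring_scope.

(** * Rooted trees *)

(* [low e] is the endpoint of [e] away from the root. *)
Record rooting (G : multigraph) (r : vert G) := Rooting {
  par : vert G -> vert G;
  low : edge G -> vert G;
  depth : vert G -> nat;
  par_root : par r = r;
  depth_par : forall x, x != r -> (depth (par x) < depth x)%N;
  low_inj : injective low;
  low_neq_root : forall e, low e != r;
  low_surj : forall x, x != r -> exists e, low e = x;
  low_ends : forall e, (src e = low e /\ tgt e = par (low e)) \/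
                       (src e = par (low e) /\ tgt e = low e) }.

Section TreeRooting.
Variables (G : multigraph) (r : vert G).

Lemma adj_sym : symmetric (@adj G).
Proof. by move=> x y; rewrite /adj; apply: eq_existsb => e; rewrite orbC. Qed.

(** Breadth-first search: a vertex first reached in the ball of radius [n.+1] about [r] has a
    neighbour in the ball of radius [n]. *)
Lemma connected_depth : (forall x, connect (@adj G) r x) ->
  exists dep : vert G -> nat,
    forall x, x != r -> exists2 y, adj y x & (dep y < dep x)%N.
Proof.
move=> conn.
pose nbhd (A : {set vert G}) : {set vert G} :=
  [set y | (y \in A) || [exists x in A, adj x y]].
pose ball n := iter n nbhd [set r].
have ballP x : exists n, x \in ball n.
  have /connectP[p] := conn x; elim/last_ind: p x => [|p z IH] x.
    by move=> _ ->; exists 0%N; rewrite inE.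
  rewrite rcons_path last_rcons => /andP[pp az] ->.
  have [n nin] := IH _ pp erefl; exists n.+1; rewrite inE.
  by apply/orP; right; apply/existsP; exists (last r p); rewrite nin az.
exists (fun x => ex_minn (ballP x)) => x xr.
case: ex_minnP => -[|n]; first by rewrite inE (negPf xr).
rewrite inE => /orP[xn /(_ _ xn)|]; first by rewrite ltnn.
case/existsP=> y /andP[yn ayx] _; exists y => //.
by case: ex_minnP => m _ /(_ _ yn).
Qed.

(* Sending each vertex [x != r] to an edge joining it to a vertex of smaller
   depth is injective, hence bijective as there are [#|V| - 1] edges. *)
Lemma tree_rooting : is_tree G -> inhabited (rooting r).
Proof.
case=> -[_ conn] cardG.
have [dep depP] := connected_depth (conn r).
pose X := {x : vert G | x != r}.
have ends (x : X) : exists ye : vert G * edge G, (dep ye.1 < dep (val x))%N /\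
    ((src ye.2 = val x /\ tgt ye.2 = ye.1) \/
     (src ye.2 = ye.1 /\ tgt ye.2 = val x)).
  have [y /existsP[e ey] dy] := depP _ (valP x); exists (y, e); split=> //.
  by case/orP: ey => /andP[/eqP-> /eqP->]; [right|left].
have [ye yeP] := choice ends.
(* Distinct vertices choosing the same edge would be its two ends, each of smaller depth than the
   other. *)
have p_inj : injective (fun x => (ye x).2).
  move=> x x' pxx'; apply: val_inj; move: (yeP x) (yeP x'); rewrite pxx'.
  move=> [dx ex] [dx' ex'].
  case: ex ex' => -[es et] [] [es' et']; try congruence.
    by move: dx dx'; rewrite -et et' -es es' => /ltn_trans h /h; rewrite ltnn.
  by move: dx dx'; rewrite -es es' -et et' => /ltn_trans h /h; rewrite ltnn.
have cardX : #|{: X}| = #|edge G|.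
  rewrite card_sig; have := cardC1 r; rewrite cardG /= => <-.
  by apply: eq_card => x; rewrite !inE.
have [q qK pK] : bijective (fun x => (ye x).2).
  by apply: inj_card_bij => //; rewrite cardX.
(* The default value makes the root its own parent. *)
pose pa x := if insub x is Some u then (ye u).1 else r.
have paE (u : X) : pa (val u) = (ye u).1 by rewrite /pa valK.
constructor; exists pa (fun e => val (q e)) dep.
- by rewrite /pa insubF ?eqxx.
- by move=> x xr; rewrite -[x]/(val (Sub x xr : X)) paE; case: (yeP (Sub x xr)).
- by move=> e e' /val_inj /(can_inj pK).
- by move=> e; exact: (valP (q e)).
- by move=> x xr; exists (ye (Sub x xr)).2; rewrite qK.
- by move=> e; rewrite paE; case: (yeP (q e)); rewrite pK.
Qed.
End TreeRooting.

Section Rooting.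
Variables (G : multigraph) (r : vert G) (rt : rooting r).

Notation pa := (par rt).
Notation lo := (low rt).

(* [x] is a descendant of [y]. *)
Definition below x y := fconnect pa x y.

Lemma below_refl x : below x x. Proof. exact: connect0. Qed.

Lemma below_trans y x z : below x y -> below y z -> below x z.
Proof. exact: connect_trans. Qed.

Lemma below_par x : below x (pa x). Proof. exact: fconnect1. Qed.

Lemma below_case x y : below x y -> x = y \/ below (pa x) y.
Proof.
move=> /iter_findex <-; case: findex => [|n]; first by left.
by right; rewrite iterSr; exact: fconnect_iter.
Qed.

Lemma below_root x : below r x -> x = r.
Proof.
by move=> /iter_findex <-; elim: findex => //= n ->; rewrite par_root.
Qed.

Lemma root_above x : below x r.
Proof.
have [n] := ubnP (depth rt x); elim: n x => // n IH x dx.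
have [->|xr] := eqVneq x r; first exact: below_refl.
apply: below_trans (below_par x) (IH _ _).
by have := depth_par rt xr; lia.
Qed.

Lemma below_depth x y : below x y -> x = y \/ (depth rt y < depth rt x)%N.
Proof.
have [n] := ubnP (depth rt x); elim: n x => // n IH x dx xy.
have [->|xny] := eqVneq x y; first by left.
have xr : x != r.
  by apply: contra_neq xny => xr; move: xy; rewrite xr => /below_root->.
case: (below_case xy) => [->|pxy]; first by left.
have dp := depth_par rt xr.
by right; case: (IH (pa x) _ pxy) => [|<-|] //; lia.
Qed.

(** The ancestors of [z] are the iterates of the parent map at [z], hence form a chain. *)
Lemma below_comparable z x y : below z x -> below z y -> below x y \/ below y x.
Proof.
move=> /iter_findex <- /iter_findex <-.
wlog le : x y / (findex pa z x <= findex pa z y)%N.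
  by move=> h; case/orP: (leq_total (findex pa z x) (findex pa z y)) => /h []; auto.
by left; rewrite -(subnK le) iterD; exact: fconnect_iter.
Qed.

(** Induction from the leaves towards the root: children have larger depth, and depth is bounded. *)
Lemma rooting_ind (Q : vert G -> Prop) :
  (forall x, (forall e, pa (lo e) = x -> Q (lo e)) -> Q x) -> forall x, Q x.
Proof.
move=> IH x; pose M := \max_y depth rt y.
have [n] := ubnP (M - depth rt x); elim: n x => // n IHn x dx.
apply: IH => e ex; apply: IHn.
have := depth_par rt (low_neq_root rt e); rewrite ex.
have : (depth rt (lo e) <= M)%N by exact: leq_bigmax.
by lia.
Qed.

Section Sums.
Variable V : nmodType.

(** [low] is a bijection from the edges onto the vertices other than the root. *)
Lemma sum_low (Q : pred (vert G)) (F : vert G -> V) :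
  \sum_(x | (x != r) && Q x) F x = \sum_(e | Q (lo e)) F (lo e).
Proof.
have [e0 _|noe] := pickP (fun _ : edge G => true); last first.
  rewrite !big1 // => [e|x /andP[/(low_surj rt)[e]]]; by have := noe e.
pose up x := odflt e0 [pick e | lo e == x].
have upK x : x != r -> lo (up x) = x.
  rewrite /up => /(low_surj rt)[e ex]; case: pickP => [e' /eqP //|/(_ e)].
  by rewrite ex eqxx.
rewrite (reindex_onto lo up) => [|x /andP[/upK]//].
apply: eq_bigl => e; rewrite low_neq_root /=.
by rewrite (low_inj (upK _ (low_neq_root rt e))) eqxx andbT.
Qed.

Definition below_sum (F : vert G -> V) x := \sum_(y | below y x) F y.

(** Every proper descendant of [x] lies below exactly one child of [x]. *)
Lemma below_sum_rec F x :
  below_sum F x = F x + \sum_(e | pa (lo e) == x) below_sum F (lo e).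
Proof.
rewrite /below_sum (bigD1 x) ?below_refl //=; congr (_ + _).
rewrite (exchange_big_dep (fun y => below y x && (y != x))) /=; last first.
  move=> e y /eqP <- yl; rewrite (below_trans yl (below_par _)) /=.
  apply: contraTneq yl => ->; apply/negP => /below_depth.
  have d := depth_par rt (low_neq_root rt e).
  by case=> [h|]; [rewrite h ltnn in d | lia].
apply: eq_bigr => y /andP[yx ynx].
have [e [ex ye]] : exists e, pa (lo e) = x /\ below y (lo e).
  have [n] := ubnP (depth rt y); elim: n y yx ynx => // n IH y yx ynx dy.
  have yr : y != r.
    by apply: contra_neq ynx => yr; move: yx; rewrite yr => /below_root->.
  have [pyx|pynx] := eqVneq (pa y) x.
    by have [e ey] := low_surj rt yr; exists e; rewrite ey pyx below_refl.
  case: (below_case yx) => [xy|/IH]; first by rewrite xy eqxx in ynx.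
  case=> // [|e [ex ye]]; first by have := depth_par rt yr; lia.
  by exists e; split=> //; exact: below_trans (below_par _) ye.
rewrite (big_pred1 e) // => e' /=; apply/andP/eqP => [[/eqP ex' ye']|->].
  (* Uniqueness: ancestors of [y] are comparable, and comparable children of [x] coincide since [x]
     is not below its own child. *)
  have aux e1 e2 : pa (lo e1) = x -> pa (lo e2) = x -> below (lo e1) (lo e2) ->
      e1 = e2.
    move=> h1 h2 /below_case[/low_inj //|]; rewrite h1 -h2 => /below_depth.
    have := depth_par rt (low_neq_root rt e2) => d [h|]; last by lia.
    by rewrite h ltnn in d.
  by case: (below_comparable ye ye') => /aux; [move=> -> | move=> ->].
by rewrite ex eqxx.
Qed.

(** Frees sums over the half-edges at [x] from the auxiliary orientation. *)
Lemma sum_src_tgt (F : edge G -> V) x :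
  \sum_(e | src e == x) F e + \sum_(e | tgt e == x) F e =
  \sum_(e | lo e == x) F e + \sum_(e | pa (lo e) == x) F e.
Proof.
rewrite ![\sum_(e | _ == _) _]big_mkcond -!big_split /=; apply: eq_bigr => e _.
by case: (low_ends rt e) => -[-> ->] //; rewrite addrC.
Qed.
End Sums.

End Rooting.

(** * Positivity of lambda along edges *)

Lemma adj_in_sym (G : multigraph) (A : {set vert G}) : symmetric (adj_in A).
Proof. by move=> x y; rewrite /adj_in adj_sym andbCA. Qed.

Lemma bigmax_gt0 (R : realType) (I : finType) (F : I -> R) :
  (0 < \big[Num.max/0]_i F i) = [exists i, 0 < F i].
Proof.
apply/idP/existsP => [|[i Fi]]; last first.
  by rewrite (bigD1 i) //= lt_max Fi.
apply: contraPP => noF; apply/negP; rewrite -leNgt.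
elim/big_ind: _ => // [x y|i _]; first by rewrite ge_max => -> ->.
by rewrite leNgt; apply/negP => Fi; apply: noF; exists i.
Qed.

Section Positivity.
Variables (R : realType) (C : admissible_cover R).
Variable lamT : vert (GamT C) -> vert (GamT C) -> R.

(* The value at the point dividing [e] in the ratio [s : 1 - s]; as [Gam -> GamT]
   is linear on edges, [s] may be read off on any edge of [Gam] above [e]. *)
Definition at_ratio (f : vert (GamT C) -> R) (e : edge (GamT C)) (s : R) : R :=
  f (src e) + s * (f (tgt e) - f (src e)).

Definition posV (x : vert (GamT C)) : bool := [exists v0, 0 < lamT v0 x].

Definition posE (e : edge (GamT C)) (s : R) : bool :=
  [exists v0, 0 < at_ratio (lamT v0) e s].

(** Quantified over all points of the closed edge, so that it is independent of any subdivision. *)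
Definition pos_edge (e : edge (GamT C)) : bool :=
  `[< forall s, 0 <= s <= 1 -> posE e s >].

Lemma posE0 e : posE e 0 = posV (src e).
Proof. by apply: eq_existsb => v0; rewrite /at_ratio mul0r addr0. Qed.

Lemma posE1 e : posE e 1 = posV (tgt e).
Proof. by apply: eq_existsb => v0; rewrite /at_ratio mul1r addrC subrK. Qed.

Lemma pos_edge_ends e : pos_edge e -> posV (src e) /\ posV (tgt e).
Proof.
by move=> /asboolP h; rewrite -posE0 -posE1; split; apply: h; rewrite lexx ler01.
Qed.

(* Each [lamT v0] is affine along the edge. *)
Lemma posE_between e (s1 s s2 : R) : s1 <= s <= s2 ->
  posE e s -> posE e s1 \/ posE e s2.
Proof.
move=> /andP[h1 h2] /existsP[v0]; rewrite /at_ratio => p.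
set f := lamT v0 in p.
have [d|d] := leP 0 (f (tgt e) - f (src e)).
  right; apply/existsP; exists v0; apply: lt_le_trans p _.
  by rewrite /at_ratio lerD2l ler_wpM2r.
left; apply/existsP; exists v0; apply: lt_le_trans p _.
by rewrite /at_ratio lerD2l ler_wnM2r // ltW.
Qed.

Lemma lam_edge_gt0 e t : (0 < lam_edge lamT e t) = posE (fE e) (t / len e).
Proof.
rewrite bigmax_gt0; apply: eq_existsb => v0.
by rewrite /on_edge /at_ratio /pullback -fE_src -fE_tgt.
Qed.

Lemma lam_vert_gt0 v : (0 < lam_vert lamT v) = posV (fV v).
Proof. by rewrite bigmax_gt0. Qed.

Variable S : subdivision C.
Notation ncuts e := (size (cuts S e)).
Notation D := (Delta_open lamT S).

Definition ratio (e : edge (Gam C)) (i : nat) : R := brk S e i / len e.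

Lemma brk_last e : brk S e (ncuts e).+1 = len e.
Proof. by rewrite /brk nth_default. Qed.

Lemma brk_lt e i j : (i < j)%N -> (j <= (ncuts e).+1)%N -> brk S e i < brk S e j.
Proof.
move=> ij jk.
(* With [len e] appended, the default value of [nth] becomes an actual last entry of a sorted
   list. *)
have brkE : brk S e =1 nth (len e) (rcons (0 :: cuts S e) (len e)).
  move=> n; rewrite nth_rcons /brk; case: ifP => // h.
  by rewrite nth_default ?if_same // leqNgt h.
rewrite !brkE; apply: (sorted_ltn_nth lt_trans) => //; 
  rewrite ?inE ?size_rcons /=; try lia.
rewrite rcons_path; apply/andP; split.
  have := @cuts_sorted _ _ S e; have := @cuts_in _ _ S e.
  case: (cuts S e) => //= a l h ->.
  by have /andP[-> _] := h a (mem_head _ _).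
case/lastP E: (cuts S e) => [|l a] /=; first exact: len_gt0.
have ain : a \in cuts S e by rewrite E mem_rcons mem_head.
by rewrite last_rcons; have /andP[_] := cuts_in ain.
Qed.

Lemma ratio0 e : ratio e 0 = 0. Proof. by rewrite /ratio /brk /= mul0r. Qed.

Lemma ratio_last e : ratio e (ncuts e).+1 = 1.
Proof. by rewrite /ratio brk_last divff // gt_eqF ?len_gt0. Qed.

Lemma ratio_lt e i j :
  (i < j)%N -> (j <= (ncuts e).+1)%N -> ratio e i < ratio e j.
Proof. by move=> ij jk; rewrite /ratio ltr_pM2r ?invr_gt0 ?len_gt0 // brk_lt. Qed.

Lemma ratio_le e i j :
  (i <= j)%N -> (j <= (ncuts e).+1)%N -> ratio e i <= ratio e j.
Proof.
rewrite leq_eqVlt => /predU1P[-> //|ij] jk; exact/ltW/ratio_lt.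
Qed.

Lemma ratio_itv e i : (i <= (ncuts e).+1)%N -> 0 <= ratio e i <= 1.
Proof. by move=> ik; rewrite -(ratio0 e) -(ratio_last e) !ratio_le. Qed.

Lemma brk_vert_last e : brk_vert S e (ncuts e).+1 = inl (tgt e).
Proof. by rewrite /= insubF ?ltnn. Qed.

Lemma brk_vert_cut e (k : 'I_(ncuts e)) :
  brk_vert S e k.+1 = inr (existT (fun e' => 'I_(ncuts e')) e k).
Proof. by rewrite /= valK. Qed.

Lemma in_Delta_vert v : ((inl v : vert (subdivided S)) \in D) = posV (fV v).
Proof. by rewrite inE /= lam_vert_gt0. Qed.

Lemma in_Delta_brk e i : (i <= (ncuts e).+1)%N ->
  ((brk_vert S e i : vert (subdivided S)) \in D) = posE (fE e) (ratio e i).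
Proof.
rewrite leq_eqVlt => /predU1P[->|].
  by rewrite brk_vert_last in_Delta_vert ratio_last posE1 fE_tgt.
case: i => [_|i ik]; first by rewrite in_Delta_vert ratio0 posE0 fE_src.
have {}ik : (i < ncuts e)%N by [].
by rewrite (brk_vert_cut (Ordinal ik)) inE /= lam_edge_gt0.
Qed.

Lemma brk_piece e t n : 0 <= t <= brk S e n.+1 ->
  exists2 i, (i <= n)%N & brk S e i <= t <= brk S e i.+1.
Proof.
move=> /andP[t0]; elim: n => [|n IH] tn; first by exists 0%N; rewrite ?t0.
have [/IH[i ? ?]|/ltW tn'] := leP t (brk S e n.+1).
  by exists i => //; exact: leqW.
by exists n.+1; rewrite ?tn'.
Qed.

(** Between consecutive breaks lambda is linear, so its value is a convex combination of two
    positive values. *)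
Lemma pos_edge_breaks e : lam_linear lamT S ->
  (forall i, (i <= (ncuts e).+1)%N -> posE (fE e) (ratio e i)) ->
  pos_edge (fE e).
Proof.
move=> lin pos; apply/asboolP => s /andP[s0 s1].
have l0 := len_gt0 e.
have sE : s = (s * len e) / len e by rewrite mulfK ?gt_eqF.
have [|i ik ti] := @brk_piece e (s * len e) (ncuts e).
  by rewrite brk_last mulr_ge0 ?(ltW l0) // ler_piMl // ltW.
have := lin e i (s * len e) ik ti.
have := brk_lt (ltnSn i) ik.
have := pos i (leqW ik); have := pos i.+1 ik.
rewrite [in X in _ -> _ -> _ -> _ -> X]sE /ratio -!lam_edge_gt0.
case/andP: ti; set a := brk _ _ _; set b := brk _ _ _.
move: (s * len e) => t at_ tb pb pa_ ab eqn.
have ba : 0 < b - a by rewrite subr_gt0.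
rewrite -(pmulr_rgt0 _ ba) eqn.
have [tb'|bt] := ltP t b.
  apply: ltr_pwDl; first by rewrite mulr_gt0 ?subr_gt0.
  by rewrite mulr_ge0 ?subr_ge0 // ltW.
have -> : t = b by apply/eqP; rewrite eq_le tb.
by rewrite subrr mul0r add0r mulr_gt0.
Qed.

Lemma adj_brk e i : (i <= ncuts e)%N ->
  @adj (subdivided S) (brk_vert S e i) (brk_vert S e i.+1).
Proof.
move=> ik; apply/existsP.
exists (existT (fun e' => 'I_(ncuts e').+1) e (Ordinal (ik : (i < (ncuts e).+1)%N))).
by rewrite !eqxx.
Qed.

Lemma adj_subdivided (x y : vert (subdivided S)) : adj x y ->
  exists e i, (i <= ncuts e)%N /\
    ((x = brk_vert S e i /\ y = brk_vert S e i.+1) \/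
     (y = brk_vert S e i /\ x = brk_vert S e i.+1)).
Proof.
case/existsP=> -[e [i ik]] h; exists e, i; split=> //.
by case/orP: h => /andP[/eqP<- /eqP<-]; [left|right].
Qed.

Lemma connect_brk e i j : (i <= j)%N -> (j <= (ncuts e).+1)%N ->
  (forall k, (i <= k <= j)%N -> posE (fE e) (ratio e k)) ->
  connect (adj_in D) (brk_vert S e i) (brk_vert S e j).
Proof.
elim: j => [|j IH]; first by rewrite leqn0 => /eqP->.
rewrite leq_eqVlt => /predU1P[-> //|ij] jk pos.
have jk' : (j <= (ncuts e).+1)%N by exact: ltnW.
apply: connect_trans (IH ij jk' _) (connect1 _).
  by move=> k /andP[ik kj]; apply: pos; rewrite ik leqW.
rewrite /adj_in !in_Delta_brk //; apply/and3P; split; last exact: adj_brk.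
  by apply: pos; rewrite -ltnS ij leqnSn.
by apply: pos; rewrite leqnn andbT ltnW.
Qed.

(* By convexity, the ratios where lambda vanishes form an interval, so a
   positive cut can be joined to one of the ends of its edge. *)
Lemma component_has_vertex (A : {set vert (subdivided S)}) :
  is_component D A -> exists v : vert (Gam C), inl v \in A.
Proof.
case=> -[v|[e k]] xD ->; first by exists v; rewrite inE connect0.
rewrite -brk_vert_cut in xD *; rewrite in_Delta_brk ?(leqW (ltn_ord k)) // in xD.
have ksz : (k.+1 <= (ncuts e).+1)%N by exact: leqW.
have [|nleft] := pselect (forall i, (0 <= i <= k.+1)%N -> posE (fE e) (ratio e i)).
  move=> pos; exists (src e); rewrite inE.
  rewrite (sym_connect_sym (@adj_in_sym _ _)).
  exact: (connect_brk (i := 0%N)).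
exists (tgt e); rewrite inE -brk_vert_last; apply: connect_brk => // i /andP[ki ik].
apply: contra_notP nleft => npos j /andP[_ jk].
have : ratio e j <= ratio e k.+1 <= ratio e i by rewrite !ratio_le.
by case/posE_between/(_ xD).
Qed.

End Positivity.

(** * The genus of a component *)

(** A path in [D] from [x] stays in the component of [x], so it is also a path for [adj_in A]. *)
Lemma n_comp_component (G : multigraph) (D A : {set vert G}) :
  is_component D A -> n_comp (adj_in A) A = 1%N.
Proof.
case=> x xD ->; set A' := [set y | _].
have symA := sym_connect_sym (@adj_in_sym G A').
have conA y : connect (adj_in D) x y -> connect (adj_in A') x y.
  case/connectP=> p; elim/last_ind: p y => [|p z IH] y.
    by move=> _ ->; exact: connect0.
  rewrite rcons_path last_rcons => /andP[pp /and3P[lD zD lz]] ->.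
  have xl : connect (adj_in D) x (last x p) by apply/connectP; exists p.
  apply: connect_trans (IH _ pp erefl) (connect1 _).
  rewrite /adj_in !inE xl lz andbT /=; apply: connect_trans xl (connect1 _).
  by rewrite /adj_in lD zD.
rewrite -(n_comp_connect symA x); apply: eq_n_comp_r => y.
rewrite inE; apply/idP/idP => [/conA //|/connectP[p]].
case/lastP: p => [_ ->|p z]; first exact: connect0.
rewrite rcons_path last_rcons => /andP[_ /and3P[_ zA _]] ->.
by rewrite inE in zA.
Qed.

(** If a vertex [m] is missing, charging each edge to its end nearer to [m] uses distinct interior
    vertices; a complete path has one edge more than interior vertices. *)
Lemma path_edges_le (a : nat -> bool) n :
  (\sum_(i < n.+1) (a i && a i.+1) <=
   \sum_(j < n) a j.+1 + [forall i : 'I_n.+2, a i])%N.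
Proof.
have allS m : [forall i : 'I_m.+1, a i] = [forall i : 'I_m, a i] && a m.
  apply/forallP/andP => [h|[/forallP h am] i].
    split; last exact: (h ord_max).
    by apply/forallP => i; apply: (h (widen_ord (leqnSn m) i)).
  have : (i <= m)%N by rewrite -ltnS.
  by rewrite leq_eqVlt => /predU1P[-> //|im]; exact: (h (Ordinal im)).
elim: n => [|n IH].
  rewrite big_ord_recl !big_ord0 !allS addn0 /=.
  by have -> : [forall i : 'I_0, a i] by apply/forallP; case.
rewrite big_ord_recr [in X in (_ <= X)%N]big_ord_recr allS /=.
move: IH; case: [forall i : 'I_n.+2, a i] (allS n.+1) => /=.
  by move=> /esym/andP[_ ->]; case: (a n.+2) => /=; lia.
by case: (a n.+1); case: (a n.+2) => /=; lia.
Qed.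

Section ComponentGenus.
Variables (R : realType) (C : admissible_cover R) (S : subdivision C).
Notation ncuts e := (size (cuts S e)).
Variable A : {set vert (subdivided S)}.

Definition old_vert : {set vert (Gam C)} := [set v | inl v \in A].

Definition whole_edges : {set edge (Gam C)} :=
  [set e | [forall i : 'I_(ncuts e).+2, brk_vert S e i \in A]].

Let cutsA := (\sum_e \sum_(j < ncuts e) (brk_vert S e j.+1 \in A))%N.

Lemma card_subdivided_set : #|A| = (#|old_vert| + cutsA)%N.
Proof.
rewrite -sum1_card big_mkcond big_sumType /=; congr (_ + _)%N.
  by rewrite -big_mkcond /= -sum1_card; apply: eq_bigl => v; rewrite inE.
rewrite /cutsA sig_big_dep /=; apply: eq_bigr => -[e j] _ /=.
by rewrite -brk_vert_cut.
Qed.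

Lemma card_inner_edges_le :
  (#|inner_edges A| <= cutsA + #|whole_edges|)%N.
Proof.
rewrite -sum1_card big_mkcond /=.
have -> : (\sum_(p : sub_edge S) (if p \in inner_edges A then 1 else 0) =
    \sum_e \sum_(i < (ncuts e).+1)
      ((brk_vert S e i \in A) && (brk_vert S e i.+1 \in A)))%N.
  by rewrite sig_big_dep /=; apply: eq_bigr => p _; rewrite inE /=; case: ifP.
rewrite -sum1_card [(\sum_(i in whole_edges) 1)%N]big_mkcond -big_split /=.
apply: leq_sum => e _; rewrite inE.
apply: leq_trans (path_edges_le (fun i => brk_vert S e i \in A) _) _.
by rewrite leq_add2l; case: [forall i, _].
Qed.

Lemma sum_sub_vgen :
  (\sum_(x in A) sub_vgen x = \sum_(v in old_vert) vgen v)%N.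
Proof.
rewrite big_mkcond big_sumType /= [X in (_ + X)%N]big1 => [|p _]; last by case: ifP.
by rewrite addn0 -big_mkcond /=; apply: eq_bigl => v; rewrite inE.
Qed.

(** Bounds the genus by data on [Gam]: the cuts in [A] offset the pieces of edges in [A], up to one
    piece for each whole edge. *)
Lemma genus_component_le (D : {set vert (subdivided S)}) : is_component D A ->
  arith_genus (@sub_vgen _ _ S) A + #|old_vert|%:Z <=
  1 + #|whole_edges|%:Z + (\sum_(v in old_vert) vgen v)%N%:Z.
Proof.
move=> /n_comp_component compA.
rewrite /arith_genus /betti1 compA sum_sub_vgen card_subdivided_set.
by have := card_inner_edges_le; lia.
Qed.

End ComponentGenus.

(** * Branch points and slopes beyond an edge of the tree *)

Section Component.
Variables (R : realType) (C : admissible_cover R).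
Variables (lamT : vert (GamT C) -> vert (GamT C) -> R).
Variables (r : vert (GamT C)) (rt : rooting r).
Notation lo := (low rt).
Notation up e := (par rt (low rt e)).
Notation pos := (pos_edge lamT).

(* The vertices joined to the root by edges on which lambda is positive. *)
Definition root_comp : {set vert (GamT C)} :=
  [set x | [forall e, below rt x (lo e) ==> pos e]].
Notation U := root_comp.

Definition exit_edge (e : edge (GamT C)) : bool := (up e \in U) && (lo e \notin U).

Lemma root_comp_root : r \in U.
Proof.
rewrite inE; apply/forallP => e; apply/implyP => /below_root h.
by have := low_neq_root rt e; rewrite h eqxx.
Qed.

Lemma root_comp_low e : (lo e \in U) = (up e \in U) && pos e.
Proof.
rewrite !inE; apply/forallP/andP => [h|[/forallP h pe] e'].
  split; last by have := h e; rewrite below_refl.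
  apply/forallP => e'; apply/implyP => ue; have := h e'.
  by rewrite (below_trans (below_par _ _) ue).
apply/implyP => /below_case[/low_inj <- //|ue].
by have := h e'; rewrite ue.
Qed.

Lemma exit_not_pos e : exit_edge e -> ~~ pos e.
Proof. by rewrite /exit_edge root_comp_low => /andP[->]. Qed.

(** Climbing from [x], take the first edge whose upper end lies in [U]. *)
Lemma below_exit x : x \notin U -> exists2 e, exit_edge e & below rt x (lo e).
Proof.
have [n] := ubnP (depth rt x); elim: n x => // n IH x dx xU.
have xr : x != r by apply: contraNneq xU => ->; exact: root_comp_root.
have [e ex] := low_surj rt xr.
have [uU|uU] := boolP (up e \in U).
  by exists e; rewrite ?ex ?below_refl // /exit_edge uU ex.
have [|e' ee' ue'] := IH (up e) _ uU.
  by have := depth_par rt xr; rewrite ex; lia.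
by exists e' => //; apply: below_trans ue'; rewrite -ex; exact: below_par.
Qed.

Lemma root_comp_posV x : posV lamT r -> x \in U -> posV lamT x.
Proof.
have [-> //|xr _] := eqVneq x r; have [e <-] := low_surj rt xr.
rewrite root_comp_low => /andP[_ /pos_edge_ends[]].
by case: (low_ends rt e) => -[-> ->].
Qed.

Lemma pos_edge_root_comp e : pos e -> (src e \in U) = (tgt e \in U).
Proof.
by move=> pe; case: (low_ends rt e) => -[-> ->]; rewrite root_comp_low pe andbT.
Qed.

Definition branch (x : vert (GamT C)) : nat := #|[set i | fV (ram C i) == x]|.

Definition branch_below (x : vert (GamT C)) : nat := below_sum rt branch x.
Notation B := branch_below.

(** This is 1 if a single edge of multiplicity two lies above [e], and 0 if two edges of
    multiplicity one do. *)
Definition ramE (e : edge (GamT C)) : nat :=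
  (\sum_(e' | fE e' == e) (mult e' - 1))%N.

Lemma sum_branch (P : pred (vert (GamT C))) :
  (\sum_(x | P x) branch x)%N = #|[set i | P (fV (ram C i))]|.
Proof.
rewrite -sum1_card (partition_big (fun i => fV (ram C i)) P) /=; last first.
  by move=> i; rewrite inE.
apply: eq_bigr => x Px; rewrite /branch -sum1_card; apply: eq_bigl => i.
by rewrite !inE andbC; case: eqP => // ->.
Qed.

Lemma branch_belowE x : B x = #|[set i | below rt (fV (ram C i)) x]|.
Proof. exact: (sum_branch (fun y => below rt y x)). Qed.

Lemma branch_below_rec x :
  B x = (branch x + \sum_(e | up e == x) B (lo e))%N.
Proof. exact: (below_sum_rec rt branch x). Qed.

Lemma branch_below_root : B r = 6%N.
Proof.
rewrite branch_belowE -[RHS](card_ord 6) -cardsT; congr #|pred_of_set _|.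
by apply/setP => i; rewrite !inE root_above.
Qed.

Lemma branch_below_mono x y : below rt x y -> (B x <= B y)%N.
Proof.
move=> xy; rewrite !branch_belowE; apply: subset_leq_card; apply/subsetP => i.
by rewrite !inE => /below_trans; apply.
Qed.

(** Incomparable vertices have no common descendant. *)
Lemma branch_below_add x y z : below rt x z -> below rt y z ->
  ~ below rt x y -> ~ below rt y x -> (B x + B y <= B z)%N.
Proof.
move=> xz yz nxy nyx; rewrite !branch_belowE -cardsUI.
rewrite [X in (_ + X)%N]eq_card0 ?addn0 => [|i]; last first.
  rewrite !inE; apply/negP => /andP[ix iy].
  by case: (below_comparable ix iy).
apply: subset_leq_card; apply/subsetP => i.
by rewrite !inE => /orP[] /below_trans; apply.
Qed.

(** Summing the recursion for [B] over [U] telescopes: edges inside [U] cancel, leaving the six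
    points below the root and the exit edges. *)
Lemma sum_branch_exit :
  (\sum_(x in U) branch x + \sum_(e | exit_edge e) B (lo e) = 6)%N.
Proof.
have h1 : (\sum_(x in U) B x = 6 + \sum_(e | lo e \in U) B (lo e))%N.
  rewrite (bigD1 r) ?root_comp_root //= branch_below_root; congr (_ + _)%N.
  rewrite -(sum_low rt (fun x => x \in U) B).
  by apply: eq_bigl => x; rewrite andbC.
have h2 : (\sum_(x in U) B x =
    \sum_(x in U) branch x + \sum_(e | up e \in U) B (lo e))%N.
  rewrite [in RHS](partition_big (fun e => up e) (fun x => x \in U)) //=.
  rewrite -big_split /=; apply: eq_bigr => x xU.
  rewrite branch_below_rec; congr (_ + _)%N; apply: eq_bigl => e.
  by case: eqP => [->|]; rewrite ?xU ?andbF.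
have h3 : (\sum_(e | up e \in U) B (lo e) =
    \sum_(e | lo e \in U) B (lo e) + \sum_(e | exit_edge e) B (lo e))%N.
  rewrite (bigID (fun e => lo e \in U)) /=; congr (_ + _)%N.
  by apply: eq_bigl => e; rewrite root_comp_low andbA andbb.
by lia.
Qed.

Lemma sum_mult_fiber (e : edge (GamT C)) :
  (\sum_(e' | fE e' == e) mult e' = 2)%N.
Proof.
rewrite -(deg_two (src e)) (partition_big (fun e' => src e') (fun v => fV v == src e)) /=.
  by apply: eq_bigr => v /eqP ve; rewrite harmonic_src.
by move=> e' /eqP <-; rewrite fE_src.
Qed.

Lemma mult_gt0 (e : edge (Gam C)) : (0 < mult e)%N.
Proof. by case: (mult12 e) => ->. Qed.

Lemma ramE_le1 e : (ramE e <= 1)%N.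
Proof.
have h : (ramE e + \sum_(e' | fE e' == e) 1 = 2)%N.
  rewrite -(sum_mult_fiber e) /ramE -big_split /=.
  by apply: eq_bigr => e' _; rewrite subnK ?mult_gt0.
have [e0 /eqP e0e|none] := pickP (fun e' => fE e' == e).
  by move: h; rewrite (bigD1 e0) ?e0e //=; lia.
by have := sum_mult_fiber e; rewrite big_pred0.
Qed.

Lemma sum_src_fiber (F : edge (Gam C) -> nat) x :
  (\sum_(v | fV v == x) \sum_(e | src e == v) F e =
   \sum_(e | src e == x) \sum_(e' | fE e' == e) F e')%N.
Proof.
rewrite (exchange_big_dep (fun e => fV (src e) == x)) /=; last by move=> v e + /eqP->.
rewrite (exchange_big_dep (fun e => fV (src e) == x)) /=; last first.
  by move=> e e' + /eqP ee'; rewrite fE_src ee'.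
apply: eq_bigr => e ex.
rewrite (big_pred1 (src e)) => [|v /=]; last first.
  by rewrite [v == _]eq_sym andbC; case: eqP => [<-|].
rewrite (big_pred1 (fE e)) // => v /=.
by rewrite [v == _]eq_sym andbC; case: eqP => [<-|] //; rewrite -fE_src.
Qed.

Lemma sum_tgt_fiber (F : edge (Gam C) -> nat) x :
  (\sum_(v | fV v == x) \sum_(e | tgt e == v) F e =
   \sum_(e | tgt e == x) \sum_(e' | fE e' == e) F e')%N.
Proof.
rewrite (exchange_big_dep (fun e => fV (tgt e) == x)) /=; last by move=> v e + /eqP->.
rewrite (exchange_big_dep (fun e => fV (tgt e) == x)) /=; last first.
  by move=> e e' + /eqP ee'; rewrite fE_tgt ee'.
apply: eq_bigr => e ex.
rewrite (big_pred1 (tgt e)) => [|v /=]; last first.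
  by rewrite [v == _]eq_sym andbC; case: eqP => [<-|].
rewrite (big_pred1 (fE e)) // => v /=.
by rewrite [v == _]eq_sym andbC; case: eqP => [<-|] //; rewrite -fE_tgt.
Qed.

(** Riemann-Hurwitz makes the total ramification at each vertex above [x] even. *)
Lemma branch_ramE_even x :
  ~~ odd (branch x + (\sum_(e | lo e == x) ramE e + \sum_(e | up e == x) ramE e)).
Proof.
have := sum_src_tgt rt ramE x; rewrite -[LHS]/(_ + _)%N -[RHS]/(_ + _)%N => <-.
have <- : (\sum_(v | fV v == x) #|[set i | ram C i == v]| = branch x)%N.
  rewrite /branch -sum1_card (partition_big (fun i => ram C i) (fun v => fV v == x)) /=.
    apply: eq_bigr => v vx; rewrite -sum1_card; apply: eq_bigl => i.
    by rewrite !inE andbC; case: eqP => // ->; rewrite vx.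
  by move=> i; rewrite inE.
rewrite -(sum_src_fiber (fun e => mult e - 1)%N) -(sum_tgt_fiber (fun e => mult e - 1)%N).
rewrite -!big_split /=.
rewrite (big_morph odd oddD (erefl : odd 0 = false)) big1 // => v _.
have := riemann_hurwitz v; set n := (X in odd X) => h.
rewrite -mulnDr -/n in h.
by have := congr1 odd h; rewrite oddD !oddM /=.
Qed.

(** Evenness at each vertex passes the parity from the edges of the children to the edge above. *)
Lemma odd_branch_below e : odd (B (lo e)) = odd (ramE e).
Proof.
suff h x : forall e', lo e' = x -> odd (B x) = odd (ramE e') by exact: h.
elim/(rooting_ind (rt := rt)): x => {e} x IH e ex.
have := branch_ramE_even x; rewrite (big_pred1 e) => [|e' /=]; last first.
  by rewrite -ex (inj_eq (@low_inj _ _ rt)).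
have h : odd (\sum_(e' | up e' == x) B (lo e'))%N =
         odd (\sum_(e' | up e' == x) ramE e')%N.
  rewrite !(big_morph odd oddD (erefl : odd 0 = false)).
  by apply: eq_bigr => e' /eqP ue; exact: IH ue _ erefl.
rewrite branch_below_rec !oddD h.
by case: (odd (branch x)); case: (odd (ramE e)); case: (odd _).
Qed.

(** Sum [Dprime + divT f] over the descendants of [lo e]: slopes inside cancel, the valence terms
    give -1, and the branch points give half their number. *)
Lemma admissible_slope v0 f e : admissible_at v0 f ->
  (f (lo e) - f (up e)) / lenT e =
  (B (lo e))%:R / 2 - 1 - (below rt v0 (lo e))%:R.
Proof.
move=> [_ adm].
pose s e := (f (lo e) - f (up e)) / lenT e.
pose F y : R := (branch y)%:R / 2 - (y == v0)%:R.
have -> : (B (lo e))%:R / 2 - 1 - (below rt v0 (lo e))%:R = below_sum rt F (lo e) - 1.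
  rewrite /below_sum sumrB -mulr_suml -natr_sum addrAC; congr (_ - _ - _).
  have [v0e|v0e] := boolP (below rt v0 (lo e)).
    by rewrite (bigD1 v0) //= eqxx big1 ?addr0 // => y /andP[_ /negPf->].
  by rewrite big1 // => y ye; case: eqP v0e => // <-; rewrite ye.
apply/eqP; rewrite eq_sym subr_eq eq_sym; apply/eqP; rewrite -/(s e).
(* [s e + 1] and [below_sum rt F] obey the same recursion; the 1 of each child edge accounts for the
   valence. *)
suff h x : forall e, lo e = x -> s e + 1 = below_sum rt F x by exact: h.
elim/(rooting_ind (rt := rt)): x => {e} x IH e ex.
rewrite below_sum_rec (eq_bigr (fun e => s e + 1)) => [|e' /eqP ue]; last first.
  by rewrite (IH e' ue e').
have := adm x.
have -> : divT f x = \sum_(e | up e == x) s e - \sum_(e | lo e == x) s e.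
  rewrite /divT ![\sum_(e | _ == _) _]big_mkcond -!sumrB /=; apply: eq_bigr => e' _.
  rewrite /slopeT /s; case: (low_ends rt e') => -[-> ->] //.
  rewrite -[f (up e') - _]opprB mulNr.
  by case: ifP; case: ifP; rewrite ?subr0 ?sub0r ?opprK // addrC.
have lox e' : (lo e' == x) = (e' == e) by rewrite -ex (inj_eq (@low_inj _ _ rt)).
have val_x : (valence x = 1 + \sum_(e | up e == x) 1)%N.
  have h : (\sum_(e | src e == x) 1 + \sum_(e | tgt e == x) 1 =
      \sum_(e | lo e == x) 1 + \sum_(e | up e == x) 1)%N.
    exact: (sum_src_tgt rt (fun=> 1%N)).
  have lo1 : (\sum_(e | lo e == x) 1 = 1)%N by exact: big_pred1 lox.
  rewrite lo1 in h.
  rewrite /valence -!sum1_card -h.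
  by congr (_ + _)%N; apply: eq_bigl => e'; rewrite inE.
rewrite (big_pred1 e lox) big_split /= /Dprime /F -/(branch x) val_x.
rewrite natrD natr_sum.
by move: (\sum_(_ | _) _) (\sum_(_ | _) _) (s e) => a b c; lra.
Qed.

End Component.

Section ComponentSet.
Variables (G : multigraph) (D A : {set vert G}).
Hypothesis A_comp : is_component D A.

Lemma component_connect x y :
  x \in A -> (y \in A) = connect (adj_in D) x y.
Proof.
have sym := sym_connect_sym (@adj_in_sym G D).
case: A_comp => z _ ->; rewrite !inE => zx.
exact: (same_connect sym zx).
Qed.

Lemma component_subset : {subset A <= D}.
Proof.
case: A_comp => z zD -> y; rewrite inE => /connectP[p].
case/lastP: p => [_ -> //|p t].
by rewrite rcons_path last_rcons => /andP[_ /and3P[_ tD _]] ->.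
Qed.

End ComponentSet.

(** * A component of genus one *)

Section GenusOne.
Variables (R : realType) (C : admissible_cover R).
Variable lamT : vert (GamT C) -> vert (GamT C) -> R.
Variables (S : subdivision C) (A : {set vert (subdivided S)}).
Hypothesis S_lam : lam_linear lamT S.
Hypothesis A_comp : is_component (Delta_open lamT S) A.
Hypothesis A_genus : arith_genus (@sub_vgen R C S) A = 1.
Variable v1 : vert (Gam C).
Hypothesis v1A : inl v1 \in A.
Variable rt : rooting (fV v1).
Notation ncuts e := (size (cuts S e)).
Notation lo := (low rt).
Notation up e := (par rt (low rt e)).
Notation pos := (pos_edge lamT).
Notation W := (old_vert A).
Notation U := (root_comp lamT rt).
Notation exit := (exit_edge lamT rt).
Notation B := (branch_below rt).

Lemma posV_root : posV lamT (fV v1).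
Proof. by rewrite -(in_Delta_vert lamT S) (component_subset A_comp). Qed.

Lemma pos_whole e : pos (fE e) -> (src e \in W) || (tgt e \in W) ->
  e \in whole_edges A.
Proof.
move=> /asboolP pe eW; rewrite inE; apply/forallP => i.
have ik : (i <= (ncuts e).+1)%N by rewrite -ltnS.
have pr k : (k <= (ncuts e).+1)%N -> posE lamT (fE e) (ratio S e k).
  by move=> kk; apply: pe; exact: ratio_itv.
case/orP: eW; rewrite inE => eA; rewrite (component_connect A_comp _ eA).
  apply: (connect_brk (i := 0%N)) => // k /andP[_ ki].
  exact: pr (leq_trans ki ik).
rewrite -brk_vert_last (sym_connect_sym (@adj_in_sym _ _)).
by apply: connect_brk => // k /andP[_]; exact: pr.
Qed.

Lemma whole_ends e : e \in whole_edges A -> src e \in W /\ tgt e \in W.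
Proof.
rewrite !inE => /forallP h; split; first exact: (h ord0).
by rewrite -brk_vert_last; exact: (h ord_max).
Qed.

Lemma whole_pos e : e \in whole_edges A -> pos (fE e).
Proof.
rewrite inE => /forallP h; apply: (pos_edge_breaks S_lam) => i ik.
rewrite -in_Delta_brk //; apply: (component_subset A_comp).
exact: (h (Ordinal (ik : (i < (ncuts e).+2)%N))).
Qed.

Lemma whole_edgesE : whole_edges A = [set e | pos (fE e) && (src e \in W)].
Proof.
apply/setP => e; apply/idP/idP => [ew|]; rewrite inE.
  by rewrite (whole_pos ew); case: (whole_ends ew).
by move=> /andP[pe eW]; apply: pos_whole; rewrite ?eW.
Qed.

Lemma pos_src_tgt e : pos (fE e) -> (src e \in W) = (tgt e \in W).
Proof.
move=> pe; apply/idP/idP => eW.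
  by have /whole_ends[] : e \in whole_edges A by apply: pos_whole; rewrite ?eW.
by have /whole_ends[] : e \in whole_edges A by apply: pos_whole; rewrite ?eW ?orbT.
Qed.

(* A vertex of the component is joined inside its edge of [Gam] to an end of
   that edge lying over [U]; this property propagates along positive pieces. *)
Lemma old_vert_root_comp v : v \in W -> fV v \in U.
Proof.
pose Z e i := (fV (src e) \in U /\
    forall j, (j <= i)%N -> posE lamT (fE e) (ratio S e j)) \/
  (fV (tgt e) \in U /\
    forall j, (i <= j <= (ncuts e).+1)%N -> posE lamT (fE e) (ratio S e j)).
pose Y (x : vert (subdivided S)) := match x with
  | inl v => fV v \in U
  | inr p => `[< Z (tag p) (tagged p).+1 >] end.
(* If every break of an edge is positive, its ends agree about [U], so both alternatives in [Z] are
   compatible. *)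
have endU e : (forall j, (j <= (ncuts e).+1)%N -> posE lamT (fE e) (ratio S e j)) ->
    (fV (src e) \in U) = (fV (tgt e) \in U).
  move=> /(pos_edge_breaks S_lam) pe.
  by rewrite fE_src fE_tgt; exact: pos_edge_root_comp.
have YZ e i : (i <= (ncuts e).+1)%N -> posE lamT (fE e) (ratio S e i) ->
    Y (brk_vert S e i) <-> Z e i.
  rewrite leq_eqVlt => /predU1P[->|ik] pi.
    rewrite brk_vert_last /Y; split.
      by move=> h; right; split=> // j; rewrite -eqn_leq => /eqP <-.
    by case=> -[//] h1 h2; rewrite -endU.
  case: i ik pi => [_|i ik] pi.
    rewrite /=; split.
      by move=> h; left; split=> // j; rewrite leqn0 => /eqP->.
    by case=> -[//] h1 h2; rewrite endU.
  have {}ik : (i < ncuts e)%N by [].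
  by rewrite (brk_vert_cut (Ordinal ik)) /Y /=; split=> /asboolP.
have step e i : (i <= ncuts e)%N ->
    brk_vert S e i \in Delta_open lamT S -> brk_vert S e i.+1 \in Delta_open lamT S ->
    Y (brk_vert S e i) <-> Y (brk_vert S e i.+1).
  move=> ik; rewrite !in_Delta_brk ?(leqW ik) // => pi pi1.
  rewrite !YZ ?(leqW ik) //; split=> -[] [eU h].
  - left; split=> // j; rewrite leq_eqVlt => /predU1P[-> //|]; exact: h.
  - by right; split=> // j /andP[ij jk]; apply: h; rewrite jk ltnW.
  - by left; split=> // j ji; apply: h; exact: leqW.
  - right; split=> // j /andP[]; rewrite leq_eqVlt => /predU1P[<- //|ij jk].
    by apply: h; rewrite ij.
have Ystep x y : adj_in (Delta_open lamT S) x y -> Y x -> Y y.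
  move=> /and3P[xD yD] /adj_subdivided[e [i [ik [] [ex ey]]]]; subst x y.
    by move/(step e i ik xD yD).
  by move/(step e i ik yD xD).
rewrite inE (component_connect A_comp _ v1A) => /connectP[p].
suff h x q : path (adj_in (Delta_open lamT S)) x q -> Y x -> Y (last x q).
  move=> pp vl; have := h _ _ pp; rewrite -vl; apply.
  exact: root_comp_root.
by elim: q x => //= y q IH x /andP[xy /IH h] /(Ystep _ _ xy).
Qed.

(** * The degree of the component over [U] *)

Definition fiber_deg x : nat := (\sum_(v | (fV v == x) && (v \in W)) ldeg v)%N.
Notation d := fiber_deg.

Lemma fiber_deg_out x : x \notin U -> d x = 0%N.
Proof.
move=> xU; rewrite /d big_pred0 // => v; apply/negP => /andP[/eqP vx].
by move=> /old_vert_root_comp; rewrite vx (negPf xU).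
Qed.

Lemma fiber_deg_src e :
  (\sum_(e' | (fE e' == e) && (src e' \in W)) mult e' = d (src e))%N.
Proof.
rewrite /d (partition_big (fun e' => src e')
  (fun v => (fV v == src e) && (v \in W))) /=; last first.
  by move=> e' /andP[/eqP <- ->]; rewrite fE_src eqxx.
apply: eq_bigr => v /andP[/eqP ve vW]; rewrite -(harmonic_src (esym ve)).
by apply: eq_bigl => e'; case: (src e' =P v) => [->|]; rewrite ?vW ?andbF ?andbT.
Qed.

Lemma fiber_deg_tgt e :
  (\sum_(e' | (fE e' == e) && (tgt e' \in W)) mult e' = d (tgt e))%N.
Proof.
rewrite /d (partition_big (fun e' => tgt e')
  (fun v => (fV v == tgt e) && (v \in W))) /=; last first.
  by move=> e' /andP[/eqP <- ->]; rewrite fE_tgt eqxx.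
apply: eq_bigr => v /andP[/eqP ve vW]; rewrite -(harmonic_tgt (esym ve)).
by apply: eq_bigl => e'; case: (tgt e' =P v) => [->|]; rewrite ?vW ?andbF ?andbT.
Qed.

(** By harmonicity both degrees count, with multiplicity, the edges above [e] that lie in the
    component. *)
Lemma fiber_deg_pos e : pos e -> d (src e) = d (tgt e).
Proof.
move=> pe; rewrite -fiber_deg_src -fiber_deg_tgt; apply: eq_bigl => e'.
by case: eqP => //= ee; apply: pos_src_tgt; rewrite ee.
Qed.

Lemma fiber_deg_low e : pos e -> d (lo e) = d (up e).
Proof. by move=> /fiber_deg_pos; case: (low_ends rt e) => -[-> ->]. Qed.

Lemma fiber_deg_const x : x \in U -> d x = d (fV v1).
Proof.
have [n] := ubnP (depth rt x); elim: n x => // n IH x dx.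
have [-> //|xr] := eqVneq x (fV v1).
have [e ex] := low_surj rt xr; have := depth_par rt xr.
rewrite -ex root_comp_low in dx * => dup /andP[uU pe].
by rewrite fiber_deg_low // IH //; lia.
Qed.

(** Each vertex of [U] other than the root matches the positive edge above it, over which the whole
    edges have total multiplicity equal to the degree. *)
Lemma sum_ldeg_whole : (\sum_(v in W) ldeg v =
  d (fV v1) + \sum_(e in whole_edges A) mult e)%N.
Proof.
have -> : (\sum_(v in W) ldeg v = \sum_x d x)%N.
  rewrite (partition_big (fun v => fV v) predT) //=.
  by apply: eq_bigr => x _; apply: eq_bigl => v; rewrite andbC.
rewrite (bigD1 (fV v1)) //=; congr (_ + _)%N.
have -> : (\sum_(x | x != fV v1) d x = \sum_e d (lo e))%N.
  by rewrite -(sum_low rt predT d); apply: eq_bigl => x; rewrite andbT.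
rewrite whole_edgesE (partition_big (fun e => fE e) (fun e => pos e)) /=; last first.
  by move=> e; rewrite inE => /andP[].
rewrite (bigID (fun e => pos e)) /= [X in (_ + X)%N]big1 ?addn0; last first.
  by move=> e ne; apply: fiber_deg_out; rewrite root_comp_low (negPf ne) andbF.
apply: eq_bigr => e pe.
have -> : d (lo e) = d (src e).
  by case: (low_ends rt e) => -[-> //]; rewrite fiber_deg_low.
rewrite -fiber_deg_src; apply: eq_bigl => e'; rewrite inE.
by case: eqP => [->|]; rewrite ?pe ?andbF ?andbT.
Qed.

(** An edge meeting the component without being whole is not positive; only its upper end can lie
    over [U], and then it lies above an exit edge. *)
Lemma ends_le_whole_exit e :
  ((src e \in W) + (tgt e \in W) <= 2 * (e \in whole_edges A) + exit (fE e))%N.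
Proof.
have [|nw] := boolP (e \in whole_edges A).
  by case: (_ \in W); case: (_ \in W); lia.
have [pe|npe] := boolP (pos (fE e)).
  have h : ~~ ((src e \in W) || (tgt e \in W)).
    by apply: contra nw; exact: pos_whole.
  by case/norP: h => /negPf-> /negPf->.
have lU : lo (fE e) \notin U by rewrite root_comp_low (negPf npe) andbF.
have WU v : v \in W -> fV v != lo (fE e).
  by move=> /old_vert_root_comp vU; apply: contraNneq lU => <-.
have WE v : v \in W -> fV v = up (fE e) -> exit (fE e).
  by move=> /old_vert_root_comp vU ve; rewrite /exit_edge -ve vU lU.
have := @fE_src _ C e; have := @fE_tgt _ C e.
case: (low_ends rt (fE e)) => -[-> ->] te se.
  have -> : (src e \in W) = false.
    by apply/negP => /WU; rewrite se eqxx.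
  by case: (boolP (tgt e \in W)) => // /WE -> //; lia.
have -> : (tgt e \in W) = false.
  by apply/negP => /WU; rewrite te eqxx.
by case: (boolP (src e \in W)) => // /WE -> //; lia.
Qed.

(** Riemann-Hurwitz for the component over [U]; the term [2g - 2] vanishes in genus one. *)
Lemma riemann_hurwitz_component :
  (2 * d (fV v1) <= #|[set i | ram C i \in W]| + \sum_(e | exit e) ramE e)%N.
Proof.
have RH : (2 * (\sum_(v in W) vgen v) + 2 * (\sum_(v in W) ldeg v) =
    2 * #|W| + (#|[set i | ram C i \in W]| +
      \sum_e (mult e - 1) * ((src e \in W) + (tgt e \in W))))%N.
  rewrite !big_distrr -sum1_card big_distrr /=.
  have -> : (#|[set i | ram C i \in W]| =
      \sum_(v in W) #|[set i | ram C i == v]|)%N.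
    rewrite -sum1_card (partition_big (fun i => ram C i) (fun v => v \in W)) /=.
      apply: eq_bigr => v vW; rewrite -sum1_card; apply: eq_bigl => i.
      by rewrite !inE andbC; case: eqP => // ->; rewrite inE in vW; rewrite vW.
    by move=> i; rewrite inE.
  have -> : (\sum_e (mult e - 1) * ((src e \in W) + (tgt e \in W)) =
      \sum_(v in W) (\sum_(e | src e == v) (mult e - 1) +
                     \sum_(e | tgt e == v) (mult e - 1)))%N.
    rewrite big_split /=.
    rewrite (exchange_big_dep predT) //= [X in (_ + X)%N](exchange_big_dep predT) //=.
    rewrite -big_split; apply: eq_bigr => e _ /=.
    have aux x : (\sum_(v in W | x == v) (mult e - 1) = (mult e - 1) * (x \in W))%N.
      have [xW|xW] := boolP (x \in W).
        rewrite muln1 (big_pred1 x) // => v /=; rewrite [v == x]eq_sym andbC.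
        by case: eqP => // <-.
      rewrite muln0 big_pred0 // => v; rewrite andbC; case: eqP => // <-.
      exact: negbTE.
    by rewrite mulnDr !aux.
  by rewrite -!big_split /=; apply: eq_bigr => v _; rewrite muln1 riemann_hurwitz.
(* Ramification on whole edges counts at both ends, above exit edges at most at one. *)
have H : (\sum_e (mult e - 1) * ((src e \in W) + (tgt e \in W)) <=
    2 * (\sum_(e in whole_edges A) (mult e - 1)) + \sum_(e | exit e) ramE e)%N.
  have -> : (\sum_(e | exit e) ramE e = \sum_(e | exit (fE e)) (mult e - 1))%N.
    rewrite [RHS](partition_big (fun e => fE e) (fun e => exit e)) //=.
    apply: eq_bigr => e ee; apply: eq_bigl => e'.
    by rewrite andbC; case: eqP => // ->.
  rewrite (big_mkcond (fun e => e \in _)) (big_mkcond (fun e => exit (fE e))).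
  rewrite big_distrr -big_split /=; apply: leq_sum => e _.
  have := ends_le_whole_exit e.
  case: (e \in whole_edges A); case: (exit (fE e)) => /= h; nia.
have M : (\sum_(e in whole_edges A) mult e =
    #|whole_edges A| + \sum_(e in whole_edges A) (mult e - 1))%N.
  rewrite -sum1_card -big_split /=; apply: eq_bigr => e _.
  by rewrite subnKC ?mult_gt0.
have := genus_component_le A_comp; rewrite A_genus.
have := sum_ldeg_whole; lia.
Qed.

Lemma fiber_deg_gt0 : (0 < d (fV v1))%N.
Proof.
rewrite /d (bigD1 v1) ?eqxx /=; last by rewrite inE.
by rewrite addn_gt0 ldeg_gt0.
Qed.

(** The other vertices in the fibre of [v] have total degree [2 - ldeg v]. *)
Lemma fiber_deg_split v :
  (d (fV v) <= 2 - ldeg v)%N && (v \notin W) || (ldeg v <= d (fV v))%N && (v \in W).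
Proof.
have [vW|vW] := boolP (v \in W); rewrite ?andbF ?andbT ?orbF /=.
  by rewrite /d (bigD1 v) ?eqxx //= leq_addr.
rewrite -(deg_two (fV v)) (bigD1 v (P := fun v' => fV v' == fV v)) //= addKn /d.
rewrite big_mkcondr /= (bigD1 v) //= (negPf vW) add0n.
by apply: leq_sum => u _; case: ifP.
Qed.

Lemma ldeg_le2 (v : vert (Gam C)) : (ldeg v <= 2)%N.
Proof. by rewrite -(deg_two (fV v)) (bigD1 v) //= leq_addr. Qed.

Lemma mult_le_ldeg (e : edge (Gam C)) :
  (mult e <= ldeg (src e))%N /\ (mult e <= ldeg (tgt e))%N.
Proof.
rewrite -(harmonic_src (esym (fE_src e))) -(harmonic_tgt (esym (fE_tgt e))).
by split; rewrite (bigD1 e) ?eqxx //= leq_addr.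
Qed.

(* If the component had degree one over [U], it would map isomorphically to a
   tree of rational curves. *)
Lemma fiber_deg_eq2 : d (fV v1) = 2%N.
Proof.
have d0 := fiber_deg_gt0.
have d2 : (d (fV v1) <= 2)%N.
  by rewrite -(deg_two (fV v1)) /d big_mkcondr leq_sum // => v _; case: ifP.
have [d1|] := eqVneq (d (fV v1)) 1%N; last by lia.
(* A vertex of local degree two would force degree 0 or 2. *)
have l1 v : fV v \in U -> ldeg v = 1%N.
  move=> vU; have := fiber_deg_split v; rewrite (fiber_deg_const vU) d1.
  by have := ldeg_le2 v; have := ldeg_gt0 v; lia.
(* Marked points and ramified edges require local degree two, so the formula would read [2 <= 0]. *)
have := riemann_hurwitz_component; rewrite d1 eq_card0 => [|i]; last first.
  rewrite !inE; apply/negP => iA; have := ldeg_ram C i; rewrite l1 //.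
  by apply: old_vert_root_comp; rewrite inE.
rewrite big1 // => e /andP[uU _]; rewrite /ramE big1 // => e' /eqP ee'.
have [] := mult_le_ldeg e'; have := @fE_src _ C e'; have := @fE_tgt _ C e'.
rewrite ee'; case: (low_ends rt e) => -[-> ->] te se.
  by rewrite (l1 (tgt e')) ?te //; lia.
by rewrite (l1 (src e')) ?se //; lia.
Qed.

(** * Degree two and the edges leaving [U] *)

Lemma root_comp_old_vert v : fV v \in U -> v \in W.
Proof.
move=> vU; have := fiber_deg_split v; rewrite (fiber_deg_const vU) fiber_deg_eq2.
by case: (v \in W) => //; have := ldeg_gt0 v; lia.
Qed.

Lemma sum_exit_le :
  (\sum_(e | exit e) B (lo e) <= 2 + \sum_(e | exit e) ramE e)%N.
Proof.
have := riemann_hurwitz_component; rewrite fiber_deg_eq2.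
have := sum_branch_exit lamT rt; rewrite sum_branch.
suff : (#|[set i | ram C i \in W]| <= #|[set i | fV (ram C i) \in U]|)%N by lia.
apply: subset_leq_card; apply/subsetP => i; rewrite !inE => iA.
by have := @old_vert_root_comp (ram C i); rewrite !inE; apply.
Qed.

(** By parity each term is twice the integer part of [B (lo e) / 2], so at most one exit edge has a
    nonzero term. *)
Lemma exit_excess_le2 : (\sum_(e | exit e) (B (lo e) - ramE e) <= 2)%N.
Proof.
have ramB e : (ramE e <= B (lo e))%N.
  by have := odd_branch_below rt e; have := ramE_le1 e; lia.
have : (\sum_(e | exit e) B (lo e) = \sum_(e | exit e) (B (lo e) - ramE e) +
    \sum_(e | exit e) ramE e)%N.
  by rewrite -big_split; apply: eq_bigr => e _ /=; rewrite subnK.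
by have := sum_exit_le; lia.
Qed.

Lemma exit_branch_le3 e : exit e -> (B (lo e) <= 3)%N.
Proof.
move=> ee; have := exit_excess_le2; rewrite (bigD1 e) //=.
by have := ramE_le1 e; lia.
Qed.

Lemma exit_branch_ge2_inj e e' : exit e -> exit e' ->
  (2 <= B (lo e))%N -> (2 <= B (lo e'))%N -> e = e'.
Proof.
move=> ee ee' b b'; apply/eqP/negPn/negP => ne.
have := exit_excess_le2; rewrite (bigD1 e) //= (bigD1 e') /=; last by rewrite ee' eq_sym.
have := odd_branch_below rt e; have := odd_branch_below rt e'.
by have := ramE_le1 e; have := ramE_le1 e'; lia.
Qed.

(* [v0] is the deepest vertex outside [U] with two branch points below it. *)
Lemma exists_decreasing : (forall v0, admissible_at v0 (lamT v0)) ->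
  exists v0, forall e, lo e \notin U -> lamT v0 (lo e) < lamT v0 (up e).
Proof.
move=> adm.
(* This inequality says that the slope given by [admissible_slope] is negative. *)
suff [v0 v0P] : exists v0, forall x, x \notin U ->
    (B x < 2 + 2 * below rt v0 x)%N.
  exists v0 => e /v0P; rewrite -subr_lt0.
  rewrite -[lamT v0 _ - _](divfK (lt0r_neq0 (lenT_gt0 e))).
  rewrite (admissible_slope rt e (adm v0)) pmulr_llt0 ?lenT_gt0 //.
  rewrite -(ltr_nat R) natrD natrM; lra.
pose P x := (x \notin U) && (1 < B x)%N.
have [x0 Px0|none] := pickP P; last first.
  by exists (fV v1) => x xU; have := none x; rewrite /P xU /=; lia.
case: (@arg_maxnP _ x0 P (depth rt)) => // v0 /andP[v0U bv0] max.
exists v0 => x xU.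
have [bx|bx] := ltnP (B x) 2; first by lia.
have [e ee xe] := below_exit xU.
have [e0 ee0 v0e] := below_exit v0U.
have eq_e : e = e0.
  exact: exit_branch_ge2_inj ee ee0 (leq_trans bx (branch_below_mono xe))
    (leq_trans bv0 (branch_below_mono v0e)).
subst e0.
(* With at most three branch points below [e], the vertices [x] and [v0] with two each cannot be
   incomparable; by maximality [x] is not strictly below [v0]. *)
have le3 := exit_branch_le3 ee.
have bxe := branch_below_mono xe.
have [|nv0x] := boolP (below rt v0 x); first by lia.
have nxv0 : ~ below rt x v0.
  move=> /below_depth[xv0|]; first by rewrite xv0 below_refl in nv0x.
  by have := max x; rewrite /P xU bx => /(_ isT); lia.
have := branch_below_add xe v0e nxv0 (negP nv0x); lia.
Qed.

End GenusOne.

(** * Decrease away from [U] and the boundary vertex *)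

Lemma affine_dec (R : realType) (a b s : R) :
  s <= 1 -> b < a -> a + s * (b - a) <= 0 -> 0 <= b -> b = 0 /\ s = 1.
Proof.
move=> s1 ba h b0.
(* The affine value is a sum of two nonnegative terms, so both vanish. *)
have h1 : (1 - s) * (a - b) + b <= 0 by lra.
have h2 : 0 <= (1 - s) * (a - b) by rewrite mulr_ge0 // subr_ge0 // ltW.
have b00 : b = 0 by lra.
split=> //; have : (1 - s) * (a - b) == 0 by apply/eqP; lra.
by rewrite mulf_eq0 !subr_eq0 (gt_eqF ba) orbF => /eqP.
Qed.

Lemma below_decreasing (G : multigraph) (r : vert G) (rt : rooting r)
    (R : realType) (f : vert G -> R) (x y : vert G) :
  (forall e, below rt (low rt e) y -> f (low rt e) < f (par rt (low rt e))) ->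
  below rt x y -> x = y \/ f x < f y.
Proof.
move=> dec; have [n] := ubnP (depth rt x); elim: n x => // n IH x dx xy.
have [->|xny] := eqVneq x y; first by left.
have xr : x != r.
  by apply: contra_neq xny => xr; move: xy; rewrite xr => /below_root->.
have [e ex] := low_surj rt xr; right.
have := dec e; rewrite ex => /(_ xy) fx.
case: (below_case xy) => [/eqP|pxy]; first by rewrite (negPf xny).
have dp := depth_par rt xr.
by case: (IH _ _ pxy) => [|<- //|]; [lia | exact: lt_trans].
Qed.

Theorem lemma3p28 (R : realType) (C : admissible_cover R)
  (lamT : vert (GamT C) -> vert (GamT C) -> R)
  (lamT_admissible : forall v0, admissible_at v0 (lamT v0))
  (lamT_normalised : forall v0, normalised (pullback (lamT v0)))
  (S : subdivision C) (S_lam : lam_linear lamT S)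
  (Delta1 : {set vert (subdivided S)})
  (Delta1_component : is_component (Delta_open lamT S) Delta1)
  (Delta1_genus : arith_genus (@sub_vgen R C S) Delta1 = 1%R) :
  exists2 x, x \in vertex_boundary Delta1 & (0 < sub_wt x)%N.
Proof.
have [v1 v1A] := component_has_vertex Delta1_component.
have [rt] := tree_rooting (fV v1) (GamT_tree C).
have posr := posV_root Delta1_component v1A.
have [v0 dec] :=
  exists_decreasing S_lam Delta1_component Delta1_genus v1A rt lamT_admissible.
set U := root_comp lamT rt in dec; set f := lamT v0 in dec.
(* Normalisation puts positive weight where [f] is nonnegative; [w] will be the boundary vertex. *)
have [w fw0 ww] : exists2 w, 0 <= f (fV w) & (0 < wt w)%N.
  have [_ h] := lamT_normalised v0.
  have [w /andP[]|none] := pickP (fun w => (0 <= f (fV w)) && (0 < wt w)%N).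
    by exists w.
  move: h; rewrite big1 // => w fw; have := none w.
  by rewrite fw /= lt0n => /negbFE/eqP.
have nposw : ~~ posV lamT (fV w).
  apply/existsP => -[u fu]; have [/(_ w fu) h _] := lamT_normalised u.
  by rewrite h in ww.
have wU : fV w \notin U by apply: contra nposw; exact: root_comp_posV.
have [e ee we] := below_exit wU.
have lU : low rt e \notin U by case/andP: ee.
(* Here [s] is measured from the upper end. If [f] were nonpositive before the lower end, it would
   be negative there and at all vertices below, including [w]. *)
have ratio_end s : s <= 1 ->
    f (par rt (low rt e)) + s * (f (low rt e) - f (par rt (low rt e))) <= 0 ->
    fV w = low rt e /\ s = 1.
  move=> s1 fs.
  have bel : fV w = low rt e \/ f (fV w) < f (low rt e).
    (* [U] is closed under ancestors, so nothing below [low rt e] lies in it. *)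
    apply: below_decreasing we => e' e'e; apply: dec; apply: contra lU => e'U.
    rewrite inE; apply/forallP => e2; apply/implyP => ee2.
    by move: e'U; rewrite inE => /forallP/(_ e2); rewrite (below_trans e'e ee2).
  have fl : 0 <= f (low rt e) by case: bel => [<- //|/ltW]; exact: le_trans.
  have [fl0 ->] := affine_dec s1 (dec _ lU) fs fl; split=> //.
  by case: bel => //; rewrite fl0 ltNge fw0.
have nposE s : ~~ posE lamT e s -> at_ratio f e s <= 0.
  by move=> np; rewrite leNgt; apply: contra np => h; apply/existsP; exists v0.
exists (inl w) => //.
(* An exit edge has a point where no [lamT u] is positive. *)
have [s] : exists2 s : R, 0 <= s <= 1 & ~~ posE lamT e s.
  have /asboolPn/existsNP[s /not_implyP[s01 /negP np]] := exit_not_pos ee.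
  by exists s.
have wD : inl w \notin Delta1.
  by apply: contra nposw => /(component_subset Delta1_component);
     rewrite in_Delta_vert.
(* Degree two over [U] means that the component contains every vertex above it. *)
have upW u : fV u = par rt (low rt e) -> inl u \in Delta1.
  move=> ue; suff : u \in old_vert Delta1 by rewrite inE.
  apply: (root_comp_old_vert S_lam Delta1_component Delta1_genus v1A (rt := rt)).
  by rewrite ue; case/andP: ee.
rewrite inE wD /= => /andP[s0 s1] /nposE.
(* If [src e] is the lower end, the ratio from the upper end is [1 - s]. *)
case: (low_ends rt e) => -[se te]; rewrite /at_ratio se te => fs.
  have [we0 _] : fV w = low rt e /\ 1 - s = 1 by apply: ratio_end; lra.
  (* Harmonicity at [w], of positive local degree, provides an edge of [Gam] above [e] there. *)
  have [e' /andP[/eqP e'e /eqP e'w]|none] :=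
    pickP (fun e' => (fE e' == e) && (src e' == w)); last first.
    have := ldeg_gt0 w; rewrite -(@harmonic_src _ _ w e) ?big_pred0 //.
    by rewrite se we0.
  (* By [ratio_end] only the end at [w] can fail to be positive, so the other breaks join the
     neighbour of [w] to the component. *)
  have pos k : (1 <= k <= (size (cuts S e')).+1)%N ->
      posE lamT (fE e') (ratio S e' k).
    move=> /andP[k1 kn]; apply: contraT; rewrite e'e => /nposE.
    rewrite /at_ratio se te => fk.
    have [_ rk] : fV w = low rt e /\ 1 - ratio S e' k = 1.
      by apply: ratio_end; have := ratio_itv kn; lra.
    by have := ratio_lt k1 kn; rewrite ratio0; lra.
  have tA : inl (tgt e') \in Delta1 by apply: upW; rewrite fE_tgt e'e.
  apply/existsP; exists (brk_vert S e' 1); apply/andP; split.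
    rewrite (component_connect Delta1_component _ tA) -brk_vert_last.
    rewrite (sym_connect_sym (@adj_in_sym _ _)); exact: connect_brk.
  by rewrite adj_sym -e'w; exact: (@adj_brk _ _ S e' 0).
(* Mirror case: the neighbour of [w] is the last break before [tgt e']. *)
have [we0 _] : fV w = low rt e /\ s = 1 by exact: ratio_end.
have [e' /andP[/eqP e'e /eqP e'w]|none] :=
  pickP (fun e' => (fE e' == e) && (tgt e' == w)); last first.
  have := ldeg_gt0 w; rewrite -(@harmonic_tgt _ _ w e) ?big_pred0 //.
  by rewrite te we0.
have pos k : (0 <= k <= size (cuts S e'))%N -> posE lamT (fE e') (ratio S e' k).
  move=> /andP[_ kn]; apply: contraT; rewrite e'e => /nposE.
  rewrite /at_ratio se te => fk.
  have [_ rk] : fV w = low rt e /\ ratio S e' k = 1.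
    by apply: ratio_end => //; have /andP[] := ratio_itv (leqW kn).
  by have := @ratio_lt _ _ S e' k (size (cuts S e')).+1 kn (leqnn _);
     rewrite ratio_last rk ltxx.
have sA : inl (src e') \in Delta1 by apply: upW; rewrite fE_src e'e.
apply/existsP; exists (brk_vert S e' (size (cuts S e'))); apply/andP; split.
  rewrite (component_connect Delta1_component _ sA).
  exact: (connect_brk (i := 0%N)).
by rewrite -e'w -brk_vert_last; exact: adj_brk.
Qed.
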